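(* For non-negative integers $n$ and $k$, not both equal to $0$, $$(1-q)^{n-k}\cdot S_q[n,k]=\sum_{j=0}^{n-k}(-q)^j\binom{n-1}{n-k-j}\begin{bmatrix} j+k-1\\ j\end{bmatrix}_q .$$
   Context: For $k\ge1$, $[k]_q=1+q+\cdots+q^{k-1}$, $[0]_q=0$, $[k]_q!=[1]_q[2]_q\cdots[k]_q$ (with $[0]_q!=1$), and the $q$-binomial coefficient is $\begin{bmatrix} a\\ b\end{bmatrix}_q=\frac{[a]_q!}{[b]_q!\,[a-b]_q!}$ for $0\le b\le a$, and $0$ otherwise except that $\begin{bmatrix} a\\ 0\end{bmatrix}_q=1$. The $q$-Stirling numbers of the second kind are defined by $S_q[n,0]=\delta_{n,0}$, $S_q[0,k]=\delta_{0,k}$ and $S_q[n,k]=S_q[n-1,k-1]+[k]_q S_q[n-1,k]$ for $n,k\ge1$; equivalently $S_q[n,k]=\sum_{w\in RG(n,k)}q^{\sum_i(w_i-1)-\binom k2}$, where $RG(n,k)$ is the set of words $w_1\cdots w_n$ of positive integers with maximal entry $k$ such that $w_i\le\max(0,w_1,\dots,w_{i-1})+1$ for all $i$. In particular $S_q[n,k]=0$ for $k>n$. The binomial coefficient $\binom{a}{b}$ is $0$ unless $0\le b\le a$. *)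

(* Defs.v *)
From HB Require Import structures.
From mathcomp Require Import all_boot all_order all_algebra.

Set Implicit Arguments.
Unset Strict Implicit.
Unset Printing Implicit Defensive.

Import Order.TTheory GRing.Theory Num.Theory.
Local Open Scope ring_scope.

Definition qint (R : nzRingType) (q : R) (k : nat) : R := \sum_(i < k) q ^+ i.

Definition qfact (R : nzRingType) (q : R) (k : nat) : R :=
  \prod_(1 <= i < k.+1) qint q i.

(* The indices are integers because [-1, 0]_q = 1 does occur as a value of
   [j + k - 1, j]_q. The quotient is the intended one only when the [i]_q,
   0 < i <= a, are nonzero; this holds when q is an indeterminate. *)
Definition qbinom (F : fieldType) (q : F) (a b : int) : F :=
  if 0 <= b <= a
  then qfact q `|a|%N / (qfact q `|b|%N * qfact q `|a - b|%N)
  else (b == 0)%:R.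

Fixpoint qstirling2 (R : nzRingType) (q : R) (n k : nat) : R :=
  match n, k with
  | 0, 0 => 1
  | n'.+1, k'.+1 => qstirling2 q n' k' + qint q k * qstirling2 q n' k
  | _, _ => 0
  end.

Definition qvar : {fraction {poly int}} := tofrac 'X.

(* Main.v *)
(** With the indices of the q-Stirling numbers shifted to make them positive,
    the sum becomes
    [U m k = \sum_j (-q)^j binom(m, k+j) qbinom(j+k, j)].
    Pascal's rule for [binom] and the q-Pascal rule
    [qbinom(j+k+1, j) = qbinom(j+k, j) + q^(k+1) qbinom(j+k, j-1)] give
    [U (m+1) (k+1) = U m k + (1 - q^(k+2)) U m (k+1)], which is the recurrence
    of the q-Stirling numbers rescaled by powers of [1 - q]. *)
Require Import Defs.
From mathcomp Require Import all_boot all_order all_algebra.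
From mathcomp Require Import ring.
Import GRing.Theory.
Local Open Scope ring_scope.

Section QIntegers.

Variables (R : nzRingType) (q : R).

Lemma qint_recr (k : nat) : qint q k.+1 = qint q k + q ^+ k.
Proof. by rewrite /qint big_ord_recr. Qed.

Lemma qint_add (j k : nat) : qint q (j + k) = qint q k + q ^+ k * qint q j.
Proof.
elim: j => [|j IHj]; first by rewrite /qint big_ord0 mulr0 addr0.
by rewrite addSn !qint_recr IHj mulrDr -exprD addrA (addnC k).
Qed.

Lemma mul_qint (k : nat) : (1 - q) * qint q k = 1 - q ^+ k.
Proof. by rewrite -[LHS]opprK -mulNr opprB -subrX1 opprB. Qed.

Lemma qfactS (k : nat) : qfact q k.+1 = qfact q k * qint q k.+1.
Proof. by rewrite /qfact big_nat_recr. Qed.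

Lemma qfact0 : qfact q 0 = 1.
Proof. by rewrite /qfact big_geq. Qed.

End QIntegers.

Section QStirling.

Variables (F : fieldType) (q : F).
Hypothesis qint_neq0 : forall i : nat, qint q i.+1 != 0.
Hypothesis q_neq1 : 1 - q != 0.

Lemma qfact_neq0 (k : nat) : qfact q k != 0.
Proof.
elim: k => [|k IHk]; first by rewrite qfact0 oner_eq0.
by rewrite qfactS mulf_neq0.
Qed.

Lemma qbinom_nat (j k : nat) :
  qbinom q (j + k)%N%:Z j%:Z = qfact q (j + k) / (qfact q j * qfact q k).
Proof.
by rewrite /qbinom lez_nat leq_addr /= PoszD addrAC subrr add0r.
Qed.

Lemma qbinom_n0 (k : nat) : qbinom q k%:Z 0 = 1.
Proof.
by rewrite (qbinom_nat 0 k) qfact0 mul1r divff // qfact_neq0.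
Qed.

Lemma qbinom_nn (j : nat) : qbinom q j%:Z j%:Z = 1.
Proof.
rewrite -[X in qbinom _ (Posz X) _]addn0 qbinom_nat qfact0 addn0 mulr1.
by rewrite divff // qfact_neq0.
Qed.

(** Up to the common factor [[j+k+1]! / ([j+1]! [k+1]!)], this is the splitting [[j+k+2] = [k+1] +
    q^(k+1) [j+1]]. *)
Lemma qbinom_pascal (j k : nat) :
  qbinom q (j.+1 + k.+1)%N%:Z j.+1%:Z =
  qbinom q (j.+1 + k)%N%:Z j.+1%:Z
    + q ^+ k.+1 * qbinom q (j + k.+1)%N%:Z j%:Z.
Proof.
rewrite !qbinom_nat !addSn !addnS !qfactS.
have -> : qint q (j + k).+2 = qint q k.+1 + q ^+ k.+1 * qint q j.+1.
  by rewrite -qint_add addSn addnS.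
have := (qint_neq0 j, qint_neq0 k, qfact_neq0 j, qfact_neq0 k).
by move=> [[[hj hk] fj] fk]; field; rewrite hj hk fj fk.
Qed.

(** The sum [U m k] above. The range does not depend on [k]; the terms with [k + j > m] vanish with
    the binomial. *)
Definition stirling_sum (m k : nat) : F :=
  \sum_(j < m.+1) (- q) ^+ j * 'C(m, k + j)%:R * qbinom q (j + k)%N%:Z j%:Z.

Lemma stirling_sum_widen (m k : nat) :
  stirling_sum m k =
  \sum_(j < m.+2) (- q) ^+ j * 'C(m, k + j)%:R * qbinom q (j + k)%N%:Z j%:Z.
Proof.
by rewrite big_ord_recr /= bin_small ?mulr0 ?mul0r ?addr0 // ltn_addl.
Qed.

(** At [k = 0] every q-binomial is 1, which leaves the binomial expansion. *)
Lemma stirling_sum0 (m : nat) : stirling_sum m 0 = (1 - q) ^+ m.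
Proof.
rewrite exprDn; apply: eq_bigr => j _.
by rewrite addn0 qbinom_nn mulr1 expr1n mul1r mulr_natr.
Qed.

Lemma stirling_sumS (m k : nat) :
  stirling_sum m.+1 k.+1 =
  stirling_sum m k + (1 - q ^+ k.+2) * stirling_sum m k.+1.
Proof.
pose t i j : F := (- q) ^+ j * 'C(m, i + j)%:R.
have -> : stirling_sum m.+1 k.+1 =
    stirling_sum m k.+1
    + \sum_(j < m.+2) t k j * qbinom q (j + k.+1)%N%:Z j%:Z.
  rewrite (stirling_sum_widen m k.+1) -big_split; apply: eq_bigr => j _ /=.
  by rewrite addSn binS natrD mulrDr mulrDl.
rewrite mulrBl mul1r addrCA; congr (_ + _).
(* The terms at [j = 0] agree. In the others, [(- q)^(j+1) q^(k+1)] from the q-Pascal rule equals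
   [- q^(k+2) (- q)^j]; widening makes the ranges match. *)
rewrite (stirling_sum_widen m k) [LHS]big_ord_recl.
rewrite [X in _ = X - _]big_ord_recl /= !qbinom_n0 -addrA.
congr (_ + _); rewrite mulr_sumr -sumrN -big_split /=.
apply: eq_bigr => j _; rewrite /bump leq0n add1n qbinom_pascal /t (addSnnS k).
by rewrite (exprS _ j) (exprS q k.+1); ring.
Qed.

(** Powers of [1 - q] on both sides avoid negative exponents when [k > n]. In the induction, the
    extra factor [1 - q] turns [[k+1]] into [1 - q^(k+1)]. *)
Lemma qstirling2_stirling_sum (n k : nat) :
  (1 - q) ^+ n * qstirling2 q n.+1 k.+1 = (1 - q) ^+ k * stirling_sum n k.
Proof.
elim: n k => [|n IHn] k.
  rewrite /stirling_sum big_ord1 addn0 bin0n /= qbinom_n0.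
  by case: k => [|k] /=; rewrite !(mulr0, mulr1, addr0, mul0r).
have -> : qstirling2 q n.+2 k.+1 =
  qstirling2 q n.+1 k + qint q k.+1 * qstirling2 q n.+1 k.+1 by [].
rewrite mulrDr mulrA exprSr -(mulrA _ (1 - q) (qint _ _)) mul_qint.
rewrite (mulrAC _ (1 - _ ^+ _)) IHn.
(* At [k = 0] the first summand vanishes and both sums are powers of [1 - q]. *)
case: k => [|k].
  by rewrite mulr0 add0r !stirling_sum0 expr0 expr1 !mul1r exprSr.
by rewrite -mulrA mulrCA IHn stirling_sumS exprS; ring.
Qed.

(** The cut must precede the symmetry of the binomial: for [k + j > n], truncated subtraction would
    give ['C(n, 0) = 1] instead of 0. *)
Lemma stirling_sum_trunc (n k : nat) :
  stirling_sum n k =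
  \sum_(0 <= j < n.+1 - k)
    (- q) ^+ j * 'C(n, n - k - j)%:R * qbinom q (j + k)%N%:Z j%:Z.
Proof.
rewrite /stirling_sum -(big_mkord xpredT (fun j =>
  (- q) ^+ j * 'C(n, k + j)%:R * qbinom q (j + k)%N%:Z j%:Z)).
rewrite (big_cat_nat (n := n.+1 - k)) ?leq_subr //= [X in _ + X]big_nat.
rewrite [X in _ + X]big1 => [|j /andP[hj _]]; last first.
  by rewrite bin_small ?mulr0 ?mul0r // -leq_subLR.
rewrite addr0; apply: eq_big_nat => j /andP[_]; rewrite ltn_subRL ltnS => hj.
by rewrite -subnDA bin_sub.
Qed.

Lemma qstirling2_closed_form (n k : nat) : ~ (n = 0%N /\ k = 0%N) ->
  (1 - q) ^ (n%:Z - k%:Z) * qstirling2 q n k =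
  \sum_(0 <= j < n.+1 - k)
    (- q) ^+ j * ('C(n.-1, n - k - j))%:R
      * qbinom q (j%:Z + k%:Z - 1) j%:Z.
Proof.
case: n k => [|n] [|k] hnk; first by case: hnk.
- by rewrite mulr0 big_geq.
(* At [k = 0], the value [[-1, 0]_q = 1] is killed by ['C(n, n+1) = 0], and [[j-1, j]_q = 0] for
   [j > 0]. *)
- rewrite mulr0 subn0 big_nat big1 // => -[|j] _.
    by rewrite subn0 bin_small ?mulr0 ?mul0r.
  have -> : j.+1%:Z + 0 - 1 = j%:Z by rewrite intS; ring.
  by rewrite /qbinom !lez_nat ltnn mulr0.
have -> : n.+1%:Z - k.+1%:Z = n%:Z - k%:Z by rewrite !intS; ring.
rewrite expfzDr // -exprnN mulrAC -exprnP qstirling2_stirling_sum.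
rewrite mulrAC divff ?expf_neq0 // mul1r stirling_sum_trunc !subSS.
apply: eq_bigr => j _; congr (_ * qbinom _ _ _).
by rewrite PoszD intS; ring.
Qed.

End QStirling.

(** The underlying polynomial has constant term 1, seen by evaluating at 0. *)
Lemma qint_qvar_neq0 (i : nat) : qint qvar i.+1 != 0.
Proof.
have -> : qint qvar i.+1 = tofrac (\sum_(j < i.+1) 'X^j : {poly int}).
  by rewrite rmorph_sum; apply: eq_bigr => j _; rewrite rmorphXn.
rewrite tofrac_eq0; apply/eqP => /(congr1 (horner^~ 0)).
rewrite horner_sum big_ord_recl big1 => [|j _]; last first.
  by rewrite hornerXn expr0n.
by rewrite hornerXn horner0.
Qed.

Lemma qvar_neq1 : 1 - qvar != 0.
Proof.
rewrite -tofrac1 -tofracB tofrac_eq0; apply/eqP => /(congr1 (horner^~ 0)).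
by rewrite !hornerE.
Qed.

(* The exponent n - k is an integer, and the sum is empty when n < k. *)
Theorem theorem9p1 (n k : nat) (hnk : ~ (n = 0%N /\ k = 0%N)) :
  (1 - qvar) ^ (n%:Z - k%:Z) * qstirling2 qvar n k =
  \sum_(0 <= j < n.+1 - k)
    (- qvar) ^+ j * ('C(n.-1, n - k - j))%:R
      * qbinom qvar (j%:Z + k%:Z - 1) j%:Z.
Proof. exact: (qstirling2_closed_form _ _ qint_qvar_neq0 qvar_neq1). Qed.
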